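(* Let $S$ be a Seidel matrix of even order $n$ with spectrum $\{ [\lambda]^a, [\mu]^b, [\nu]^2 \}$. Assume that at least one of the numbers $|n-1+\lambda\mu|$, $|n-1+\lambda\mu|/2$, $|n-1+\lambda\mu|/4$ is a prime congruent to $3$ modulo $4$. Then the $\nu$-eigenspace of $S$ is regular.
   Context: A Seidel matrix is a symmetric $\{0,\pm1\}$-matrix with zero diagonal and all off-diagonal entries nonzero. The notation $\{[\lambda]^a,[\mu]^b,[\nu]^c\}$ for the spectrum means that the matrix has precisely three distinct eigenvalues $\lambda,\mu,\nu$ (pairwise distinct real numbers, in no particular order) with positive multiplicities $a,b,c$ respectively. An eigenspace of a Seidel matrix is called regular if it contains a vector all of whose entries are $\pm1$. *)

(* Defs.v *)
From mathcomp Require Import all_boot all_order all_algebra.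

Set Implicit Arguments.
Unset Strict Implicit.
Unset Printing Implicit Defensive.

Import Order.TTheory GRing.Theory Num.Theory.

Local Open Scope ring_scope.

Definition seidel (R : rcfType) (n : nat) (S : 'M[R]_n) : Prop :=
  [/\ S^T = S, forall i, S i i = 0
    & forall i j, i != j -> S i j = 1 \/ S i j = -1].

(* The spectrum is the multiset of roots of the characteristic polynomial;
   [has_spectrum_eigenvalue] and [has_spectrum_mult] below spell this out. *)
Definition has_spectrum (R : rcfType) (n : nat) (S : 'M[R]_n)
    (s : seq (R * nat)) : Prop :=
  [/\ uniq (unzip1 s), {in s, forall xm, (0 < xm.2)%N}
    & char_poly S = \prod_(xm <- s) ('X - xm.1%:P) ^+ xm.2].

Definition prime_3mod4 (R : rcfType) (x : R) : Prop :=
  exists p : nat, [/\ prime p, p = 3 %[mod 4] & x = p%:R].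

(* [eigenspace] consists of row vectors; as S is symmetric, transposition
   identifies them with the usual column eigenvectors. *)
Definition regular_eigenspace (R : rcfType) (n : nat) (S : 'M[R]_n) (x : R)
    : Prop :=
  exists v : 'rV[R]_n,
    (v <= eigenspace S x)%MS /\ forall i, v 0 i = 1 \/ v 0 i = -1.

Lemma root_prod_XsubC_exp (R : rcfType) (s : seq (R * nat)) :
  {in s, forall xm, (0 < xm.2)%N} ->
  forall x, root (\prod_(xm <- s) ('X - xm.1%:P) ^+ xm.2) x = (x \in unzip1 s).
Proof.
elim: s => [|[y m] s IHs] s_gt0 x; first by rewrite big_nil (negbTE (root1 _)).
rewrite big_cons rootM IHs => [|z zs]; last by apply: s_gt0; rewrite inE zs orbT.
have /= m_gt0 := s_gt0 (y, m) (mem_head _ _).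
by rewrite /= inE -(prednK m_gt0) root_exp_XsubC.
Qed.

Lemma has_spectrum_eigenvalue (R : rcfType) (n : nat) (S : 'M[R]_n)
    (s : seq (R * nat)) :
  has_spectrum S s -> forall x, eigenvalue S x = (x \in unzip1 s).
Proof.
by case=> _ s_gt0 defS x; rewrite eigenvalue_root_char defS root_prod_XsubC_exp.
Qed.

Lemma has_spectrum_mult (R : rcfType) (n : nat) (S : 'M[R]_n)
    (s : seq (R * nat)) :
  has_spectrum S s -> {in s, forall xm, mup xm.1 (char_poly S) = xm.2}.
Proof.
case=> s_uniq s_gt0 -> {S}; elim: s s_uniq s_gt0 => [|[y m] s IHs] //=.
move=> /andP[ys s_uniq] s_gt0 [x k].
have s'_gt0 : {in s, forall xm, (0 < xm.2)%N}.
  by move=> z zs; apply: s_gt0; rewrite inE zs orbT.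
rewrite inE big_cons => /predU1P[[-> ->]|xs] /=.
  by rewrite mupMl ?root_prod_XsubC_exp // mup_XsubCX eqxx.
have /= m_gt0 := s_gt0 (y, m) (mem_head _ _).
rewrite mupMr ?(IHs _ _ _ xs) // -(prednK m_gt0).
rewrite root_exp_XsubC; apply: contraNneq ys => <-.
exact: (map_f fst xs).
Qed.

(* Main.v *)
Require Import Defs.
From mathcomp Require Import all_boot all_order all_algebra.
From mathcomp Require Import finfield zify ring lra.

Import Order.TTheory GRing.Theory Num.Theory.
Local Open Scope ring_scope.

(* Put M = (S - lambda)(S - mu) and d = n - 1 + lambda mu.  M is a multiple of
   the orthogonal projection onto the nu-eigenspace, so up to sign it is the Gram
   matrix of n vectors in a plane, and its diagonal is constantly d, whence
   M^2 = (n d / 2) M.  By Gauss' lemma and reduction modulo 2, lambda + mu is an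
   even integer, lambda mu and nu are odd integers, and M has even entries; a
   further parity argument shows that M has entries divisible by 4 if d is.  Hence
   Q = M / c is integral with diagonal p for some c among +-2, +-4.  The 3 x 3
   minors of Q vanish and Q^2 = (n p / 2) Q; read modulo p, this forces Q to have
   a zero entry Q i j.  Then (Q i l)^2 + (Q j l)^2 = p^2 for all l, and as
   p = 3 mod 4 one of the two summands is 0: the sum of the rows i and j of Q,
   divided by p, has all entries +-1. *)

(** * Integers and sums of two squares modulo a prime *)

Lemma int_sq_small (x : int) : x ^+ 2 < 1 -> x = 0.
Proof.
move=> x1; apply/eqP; apply: contraTT x1 => x0.
by rewrite -leNgt -sqrf_eq0 in x0 *; move: (sqr_ge0 x) x0; lia.
Qed.

Lemma dvdz_prime_cases (p : nat) (x : int) :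
  (0 < p)%N -> (p%:Z %| x)%Z -> x ^+ 2 <= p%:Z ^+ 2 -> x ^+ 2 = p%:Z ^+ 2 \/ x = 0.
Proof.
move=> p0 /dvdzP[y ->]; rewrite exprMn => le1.
have p20 : 0 < p%:Z ^+ 2 by rewrite exprn_gt0.
have y1 : y ^+ 2 <= 1 by rewrite -(ler_pM2r p20) mul1r.
have := sqr_ge0 y; have : y ^+ 2 != 1 -> y = 0.
  by move=> yn1; apply: int_sq_small; rewrite lt_neqAle yn1.
case: (eqVneq (y ^+ 2) 1) => [-> _ _|_ /(_ isT) -> _].
  by left; rewrite mul1r.
by right; rewrite mul0r.
Qed.

(** If [a] is not 0 modulo [p], then [x ^+ 2 = - y ^+ 2] with both nonzero; raising this to half of
    [p.-1], an odd number, gives [1 = -1] by Fermat's little theorem. *)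
Lemma sum_sq_prime3mod4 (p : nat) (a b : int) : prime p -> p = 3 %[mod 4] ->
  (p%:Z %| a ^+ 2 + b ^+ 2)%Z -> (p%:Z %| a)%Z.
Proof.
move=> pp p34; rewrite !(dvdz_pcharf (pchar_Fp pp)) rmorphD !rmorphXn /=.
move: (a%:~R) (b%:~R) => {a b} x y xy0.
have fermat (z : 'F_p) : z != 0 -> z ^+ p.-1 = 1.
  move=> z0; apply: (mulfI z0).
  by rewrite -exprS prednK ?prime_gt0 // mulr1 -{2}[z]expf_card card_Fp.
have pE : p.-1 = (2 * (2 * (p %/ 4)).+1)%N.
  by have := divn_eq p 4; rewrite p34; lia.
apply/eqP; apply: contraTeq isT => x0.
have xE : x ^+ 2 = - y ^+ 2 by apply/eqP; rewrite -addr_eq0.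
have y0 : y != 0 by apply: contraNneq x0 => y0; rewrite -sqrf_eq0 xE y0 expr0n oppr0.
have := fermat x x0; rewrite pE exprM xE exprNn -exprM -pE fermat // mulr1.
rewrite -signr_odd /= oddM /= expr1 => /eqP; rewrite eq_sym -addr_eq0.
rewrite -[_ + _]/(2%:R) -(dvdn_pcharf (pchar_Fp pp)) dvdn_prime2 //.
by move=> /eqP p2; rewrite p2 in p34.
Qed.

Lemma prime_dvdzM (p : nat) (a b : int) : prime p ->
  (p%:Z %| a * b)%Z = (p%:Z %| a)%Z || (p%:Z %| b)%Z.
Proof. by move=> pp; rewrite !dvdzE abszM /= Euclid_dvdM. Qed.

(** * Gram matrices of rank two with prime diagonal *)

Lemma rank2_gram_sum (n k p : nat) (Q : 'M[int]_n) : prime p -> p = 3 %[mod 4] ->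
  n = k.*2 -> (0 < n)%N -> Q^T = Q -> Q *m Q = (k * p)%:Z *: Q ->
  (forall i, Q i i = p%:Z) ->
  (forall i j l, p%:Z ^+ 3 + 2 * Q i j * Q i l * Q j l
     = p%:Z * (Q i j ^+ 2 + Q i l ^+ 2 + Q j l ^+ 2)) ->
  exists i j, forall l, (Q i l + Q j l) ^+ 2 = p%:Z ^+ 2.
Proof.
move=> pp p34 nk n0 symQ QQ dQ minorQ.
have p0 : (0 < p)%N by apply: prime_gt0.
have pZ0 : p%:Z != 0 by rewrite -lt0n in p0 *; lia.
have Qsym i j : Q i j = Q j i by rewrite -[in LHS]symQ mxE.
have QQE i j : \sum_l Q i l * Q j l = (k * p)%:Z * Q i j.
  move/matrixP: QQ => /(_ i j); rewrite !mxE => <-.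
  by apply: eq_bigr => l _; rewrite (Qsym j l).
have kp0 : (0 : int) < (k * p)%:Z by move: n0; rewrite nk; lia.
have rowsq i : \sum_l Q i l ^+ 2 = (k * p)%:Z * p%:Z.
  by rewrite -[in RHS](dQ i) -QQE; apply: eq_bigr.
(* Cauchy-Schwarz: the difference and the sum of rows [i] and [j] have squared norms
   [2 k p (p - Q i j)] and [2 k p (p + Q i j)]. *)
have leQ i j : Q i j ^+ 2 <= p%:Z ^+ 2.
  have c1 : 0 <= \sum_l (Q i l - Q j l) ^+ 2 by apply: sumr_ge0 => l _; apply: sqr_ge0.
  have c2 : 0 <= \sum_l (Q i l + Q j l) ^+ 2 by apply: sumr_ge0 => l _; apply: sqr_ge0.
  have e1 : \sum_l (Q i l - Q j l) ^+ 2 = 2 * (k * p)%:Z * (p%:Z - Q i j).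
    transitivity (\sum_l (Q i l ^+ 2 + Q j l ^+ 2 - 2 * (Q i l * Q j l))).
      by apply: eq_bigr => l _; ring.
    by rewrite sumrB big_split /= -mulr_sumr !rowsq QQE; ring.
  have e2 : \sum_l (Q i l + Q j l) ^+ 2 = 2 * (k * p)%:Z * (p%:Z + Q i j).
    transitivity (\sum_l (Q i l ^+ 2 + Q j l ^+ 2 + 2 * (Q i l * Q j l))).
      by apply: eq_bigr => l _; ring.
    by rewrite !big_split /= -mulr_sumr !rowsq QQE; ring.
  have kp2 : 0 < 2 * (k * p)%:Z by lia.
  rewrite e1 pmulr_rge0 // in c1; rewrite e2 pmulr_rge0 // in c2.
  suff : 0 <= (p%:Z - Q i j) * (p%:Z + Q i j) by rewrite -subr_sqr; lia.
  exact: mulr_ge0.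
have [/existsP[i /existsP[j /eqP Qij]]|nozero] :=
  boolP [exists i, exists j, Q i j == 0].
  exists i, j => l.
  have /(mulfI pZ0) e : p%:Z * (p%:Z ^+ 2) = p%:Z * (Q i l ^+ 2 + Q j l ^+ 2).
    by have := minorQ i j l; rewrite Qij => e; rewrite -exprS; lia.
  have dv : (p%:Z %| Q i l)%Z.
    by apply: (@sum_sq_prime3mod4 p _ (Q j l)) => //; rewrite -e expr2 dvdz_mulr.
  case: (dvdz_prime_cases p _ p0 dv (leQ i l)) => e1.
    have /eqP : Q j l ^+ 2 = 0 by rewrite e1 in e; lia.
    by rewrite sqrf_eq0 => /eqP->; rewrite addr0.
  by rewrite e1 add0r e e1; ring.
(* No entry vanishes. Modulo p the minors then say that among any three rows two
   agree up to sign; comparing row norms contradicts Q i j != 0. *)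
exfalso.
have nz i j : Q i j != 0.
  by apply: contra nozero => q0; apply/existsP; exists i; apply/existsP; exists j.
pose i : 'I_n := Ordinal n0.
(* If all entries of row [i] were [+-p], its squared norm would be [2 k p^2] instead of [k p^2]; so
   some [Q i j] is neither 0 nor [+-p], hence prime to [p]. *)
have [/forallP alls|] := boolP [forall j, Q i j ^+ 2 == p%:Z ^+ 2].
  have := rowsq i; rewrite (eq_bigr (fun=> p%:Z ^+ 2)) => [|j _]; last exact/eqP.
  rewrite sumr_const card_ord nk -mulr_natr => e.
  have : p%:Z ^+ 2 * k%:Z = 0 by move: e; nia.
  by move/eqP; rewrite mulf_eq0 sqrf_eq0 (negPf pZ0); nia.
rewrite negb_forall => /existsP[j Qij].
have Ndv : ~~ (p%:Z %| Q i j)%Z.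
  apply/negP => dv; case: (dvdz_prime_cases p _ p0 dv (leQ i j)) => e.
    by rewrite e eqxx in Qij.
  by have := nz i j; rewrite e eqxx.
(* When [a] is [+-p], the minor relation times [p] becomes [(p b - a Q i j)^2 = 0], so
   [b ^+ 2 = Q i j ^+ 2]. *)
have ppmB (a b : int) : a ^+ 2 = p%:Z ^+ 2 ->
    p%:Z ^+ 3 + 2 * Q i j * a * b = p%:Z * (Q i j ^+ 2 + a ^+ 2 + b ^+ 2) ->
    a ^+ 2 + b ^+ 2 = p%:Z ^+ 2 + Q i j ^+ 2.
  move=> e1 e2.
  have : (p%:Z * b - a * Q i j) ^+ 2 = 0.
    rewrite sqrrB !exprMn e1.
    move/(congr1 (fun x => x * p%:Z)): e2; rewrite e1 => e2.
    lra.
  move/eqP; rewrite sqrf_eq0 => /eqP e3.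
  have : p%:Z ^+ 2 * b ^+ 2 = p%:Z ^+ 2 * Q i j ^+ 2.
    by rewrite -[in RHS]e1 -!exprMn; congr (_ ^+ 2); lia.
  have p2 : p%:Z ^+ 2 != 0 by rewrite sqrf_eq0.
  by move/(mulfI p2) => ->; rewrite e1.
(* [p] divides [2 Q i j Q i l Q j l] but neither 2 nor [Q i j], so it divides [Q i l] or [Q j l],
   which is then [+-p]. *)
have sumE l : Q i l ^+ 2 + Q j l ^+ 2 = p%:Z ^+ 2 + Q i j ^+ 2.
  have mn := minorQ i j l.
  have : (p%:Z %| 2 * (Q i j * (Q i l * Q j l)))%Z.
    have -> : 2 * (Q i j * (Q i l * Q j l)) =
        p%:Z * (Q i j ^+ 2 + Q i l ^+ 2 + Q j l ^+ 2 - p%:Z ^+ 2).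
      by rewrite mulrBr -mn; ring.
    exact: dvdz_mulr.
  have Nd2 : ~~ (p%:Z %| 2)%Z.
    rewrite dvdzE /= dvdn_prime2 //; apply/eqP => p2; by rewrite p2 in p34.
  rewrite prime_dvdzM // (negPf Nd2) prime_dvdzM // (negPf Ndv) prime_dvdzM //=.
  case/orP => dv.
    case: (dvdz_prime_cases p _ p0 dv (leQ i l)) => e.
      by apply: ppmB.
    by have := nz i l; rewrite e eqxx.
  case: (dvdz_prime_cases p _ p0 dv (leQ j l)) => e.
    rewrite addrC; apply: ppmB => //.
    by rewrite mulrAC mn; ring.
  by have := nz j l; rewrite e eqxx.
have : \sum_l (Q i l ^+ 2 + Q j l ^+ 2) = \sum_(l < n) (p%:Z ^+ 2 + Q i j ^+ 2).
  by apply: eq_bigr => l _; apply: sumE.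
rewrite big_split /= !rowsq sumr_const card_ord -mulr_natr.
have -> : n%:R = 2 * k%:Z by rewrite nk natz; lia.
move=> e; have : Q i j ^+ 2 * k%:Z = 0 by move: e; nia.
move/eqP; rewrite mulf_eq0 sqrf_eq0 (negPf (nz i j)); nia.
Qed.

(** * Reduction modulo 2 *)

Lemma F2_two : 2 = 0 :> 'F_2.
Proof. by apply/eqP. Qed.

Lemma F2_idem (x : 'F_2) : x ^+ 2 = x.
Proof. by rewrite -[RHS]expf_card card_Fp. Qed.

Lemma F2_dvd (x : int) : (2%:Z %| x)%Z = (x%:~R == 0 :> 'F_2).
Proof. exact: (dvdz_pcharf (pchar_Fp (isT : prime 2))). Qed.

Lemma F2_addxx (x : 'F_2) : x + x = 0.
Proof. by rewrite -mulr2n -mulr_natr F2_two mulr0. Qed.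

Lemma F2_opp (x : 'F_2) : - x = x.
Proof. by apply/eqP; rewrite eq_sym -addr_eq0 F2_addxx. Qed.

Lemma F2_even (x : int) : (2 * x)%:~R = 0 :> 'F_2.
Proof. by apply/eqP; rewrite -F2_dvd dvdz_mulr. Qed.

(** Entries off the diagonal come in equal pairs, which cancel in characteristic 2. *)
Lemma sum_alternating_F2 (n : nat) (N : 'M['F_2]_n) :
  N^T = N -> (forall i, N i i = 0) -> \sum_i \sum_j N i j = 0.
Proof.
move=> symN dN.
have Nsym i j : N i j = N j i by rewrite -[in LHS]symN mxE.
have split3 i : \sum_j N i j =
    \sum_(j < n | (i < j)%N) N i j + \sum_(j < n | (j < i)%N) N i j.
  rewrite (bigID (fun j : 'I_n => i < j)%N) /=; congr (_ + _).
  rewrite (bigD1 i) ?ltnn //= dN add0r; apply: eq_bigl => j.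
  by rewrite -leqNgt -val_eqE /= ltn_neqAle andbC.
under eq_bigr do rewrite split3; rewrite big_split /=.
rewrite [X in _ + X](exchange_big_dep xpredT) //=.
rewrite -big_split /= big1 // => i _; rewrite [X in _ + X](eq_bigr (N i)) //.
by rewrite F2_addxx.
Qed.

(* In the application N is the 0/1 indicator of the entries -1 of S. Modulo 2,
   W i j is h i + h j with h i the i-th row sum of N; the eigenvalue equation for W, halved,
   makes h constant modulo 2. *)
Lemma seidel_gram_even (n k : nat) (S N W : 'M[int]_n) (tau e d q : int) :
  n = k.*2 -> N^T = N -> (forall i, N i i = 0) ->
  S = const_mx 1 - 1%:M - 2 *: N ->
  S *m S - (2 * tau) *: S + (2 * e - 1)%:M = 2 *: W ->
  W *m W = (k%:Z * d) *: W -> W^T = W -> S *m W = (2 * q - 1) *: W ->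
  (forall i, W i i = d) -> (2 %| d)%Z ->
  forall i j, (2 %| W i j)%Z.
Proof.
move=> nk symN dN defS SS WW symW SW dW d2.
have nZ : n%:Z = 2 * k%:Z by rewrite nk; lia.
have Nsym i j : N i j = N j i by rewrite -[in LHS]symN mxE.
have Wsym i j : W i j = W j i by rewrite -[in LHS]symW mxE.
pose h i := \sum_l N i l.
have SE i j : S i j = 1 - (i == j)%:R - 2 * N i j by rewrite defS !mxE.
(* Expansion of [SS] for [S = J - I - 2 N] with [J] the all-ones matrix, halved; the [k] comes from
   [J *m J = n J]. *)
have WE i j : W i j = k%:Z - 1 - tau - h i - h j
    + 2 * (N i j + \sum_l N i l * N l j + tau * N i j) + (tau + e) * (i == j)%:R.
  have /(mulfI (isT : (2 : int) != 0)) // : 2 * W i j = 2 * (k%:Z - 1 - tau - h i - h j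
    + 2 * (N i j + \sum_l N i l * N l j + tau * N i j) + (tau + e) * (i == j)%:R).
  have := congr1 (fun A : 'M_n => A i j) SS; rewrite !mxE SE => <-.
  have -> : \sum_l S i l * S l j = n%:Z - 2 + (i == j)%:R - 2 * h i - 2 * h j
      + 4 * N i j + 4 * \sum_l N i l * N l j.
    transitivity (\sum_l (1 - (i == l)%:R - (l == j)%:R + (i == l)%:R * (l == j)%:R
        - 2 * N i l - 2 * N j l + 2 * ((i == l)%:R * N l j) + 2 * (N i l * (l == j)%:R)
        + 4 * (N i l * N l j))).
      by apply: eq_bigr => l _; rewrite !SE (Nsym j l); ring.
    rewrite !(big_split, sumrB) /= -!mulr_sumr sumrN sumrN.
    have d1 (F : 'I_n -> int) : \sum_l (i == l)%:R * F l = F i.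
      rewrite (bigD1 i) //= eqxx mul1r big1 ?addr0 // => l.
      by rewrite eq_sym => /negPf->; rewrite mul0r.
    have d3 (F : 'I_n -> int) : \sum_l F l * (l == j)%:R = F j.
      rewrite (bigD1 j) //= eqxx mulr1 big1 ?addr0 // => l.
      by move=> /negPf->; rewrite mulr0.
    rewrite !d1 !d3 sumr_const card_ord.
    have d1' : \sum_(l < n) (i == l)%:R = 1 :> int.
      by rewrite -[RHS](d1 (fun=> 1)); apply: eq_bigr => l _; rewrite mulr1.
    have d3' : \sum_(l < n) (l == j)%:R = 1 :> int.
      by rewrite -[RHS](d3 (fun=> 1)); apply: eq_bigr => l _; rewrite mul1r.
    rewrite d1' d3' sumrN sumrN -!mulr_sumr -/(h i) -/(h j) natz.
    by ring.
  rewrite nZ -mulr_natr; move: (\sum_l _) => X; move: (h i) (h j) => hi hj.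
  by case: (i == j) => /=; ring.
pose x i : 'F_2 := (h i)%:~R.
pose c : 'F_2 := (k%:Z - 1 - tau)%:~R.
have wE i j : (W i j)%:~R = c + x i + x j + (tau + e)%:~R * (i == j)%:R :> 'F_2.
  rewrite WE; move: (_ + _ + tau * _) => X.
  rewrite rmorphD rmorphD /= F2_even addr0 rmorphM /= rmorph_nat.
  congr (_ + _); rewrite rmorphB rmorphB /= -/(x i) -/(x j) -/c.
  by rewrite !F2_opp.
have d0 : d%:~R = 0 :> 'F_2 by apply/eqP; rewrite -F2_dvd.
have ni0 : n%:R = 0 :> 'F_2 by rewrite nk -muln2 natrM F2_two mulr0.
have H0 : \sum_i x i = 0.
  pose NF := map_mx (fun z : int => z%:~R : 'F_2) N.
  rewrite -[RHS](@sum_alternating_F2 _ NF) => [||i].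
  - apply: eq_bigr => i _; rewrite /x rmorph_sum /=.
    by apply: eq_bigr => l _; rewrite mxE.
  - by apply/matrixP => i j; rewrite !mxE Nsym.
  by rewrite mxE dN.
have dE (i : 'I_n) : c + (tau + e)%:~R = 0 :> 'F_2.
  rewrite -d0 -(dW i) wE eqxx mulr1.
  by rewrite -[c + x i + x i]addrA F2_addxx addr0.
(* Squaring is the identity on ['F_2], so the diagonal of [W *m W] holds the row sums of [W]. There
   [c] and [x i] occur an even number [n] of times and the [x l] add up to 0 by [H0], which leaves
   [tau + e]. *)
have te0 (i : 'I_n) : (tau + e)%:~R = 0 :> 'F_2.
  have := congr1 (fun A : 'M_n => (A i i)%:~R : 'F_2) WW.
  rewrite !mxE dW rmorphM /= d0 mulr0 rmorph_sum /= => <-.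
  transitivity (\sum_l (c + x i + x l + (tau + e)%:~R * (i == l)%:R)).
    rewrite !big_split /= H0 !sumr_const card_ord -[c *+ n]mulr_natr -[x i *+ n]mulr_natr.
    rewrite ni0 !mulr0 !add0r -mulr_sumr (bigD1 i) //= eqxx big1 ?addr0 ?mulr1 // => l.
    by rewrite eq_sym => /negPf->.
  by apply: eq_bigr => l _; rewrite rmorphM /= (Wsym l i) -expr2 F2_idem wE.
have c0 (i : 'I_n) : c = 0 by have := dE i; rewrite te0 // addr0.
have {}wE i j : (W i j)%:~R = x i + x j :> 'F_2.
  by rewrite wE (c0 i) (te0 i) mul0r add0r addr0.
(* S *m W = (2 q - 1) *: W says that 2 P i j is the j-th column sum of W. *)
pose P i j := q * W i j + \sum_l N i l * W l j.
have Pconst i i' j : P i j = P i' j.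
  have PE m : 2 * P m j = \sum_l W l j.
    have := congr1 (fun A : 'M_n => A m j) SW; rewrite !mxE => e1.
    have : \sum_l S m l * W l j = \sum_l W l j - W m j - 2 * \sum_l N m l * W l j.
      have -> : W m j = \sum_l (m == l)%:R * W l j.
        rewrite (bigD1 m) //= eqxx mul1r big1 ?addr0 // => l.
        by rewrite eq_sym => /negPf->; rewrite mul0r.
      rewrite mulr_sumr -!sumrB; apply: eq_bigr => l _; rewrite SE; ring.
    by rewrite e1 /P => e2; lra.
  by apply: (mulfI (isT : (2 : int) != 0)); rewrite !PE.
pose g i := \sum_l (N i l)%:~R * x l : 'F_2.
have PF i j : (P i j)%:~R = q%:~R * (x i + x j) + g i + x i * x j.
  rewrite /P rmorphD rmorphM /= wE -addrA; congr (_ + _).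
  have xE : x i = \sum_l (N i l)%:~R by rewrite /x rmorph_sum.
  rewrite [in RHS]xE rmorph_sum /= mulr_suml -big_split /=.
  by apply: eq_bigr => l _; rewrite rmorphM /= wE mulrDr.
(* In the mixed second difference of [P] at [i] and [i'], which is 0, only the product [x i * x j]
   contributes: it leaves [(x i - x i') ^+ 2]. *)
have xconst i i' : x i = x i'.
  have e1 := congr1 (fun z : int => z%:~R : 'F_2) (Pconst i i' i).
  have e2 := congr1 (fun z : int => z%:~R : 'F_2) (Pconst i i' i').
  rewrite /= !PF in e1 e2; move/eqP: e1; move/eqP: e2.
  rewrite -subr_eq0 => /eqP e2; rewrite -subr_eq0 => /eqP e1.
  have : (x i - x i') ^+ 2 = 0.
    have := congr2 (fun u v : 'F_2 => u - v) e1 e2.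
    by rewrite /= subrr => <-; ring.
  by rewrite F2_idem => /eqP; rewrite subr_eq0 => /eqP.
by move=> i j; rewrite F2_dvd wE (xconst i j) F2_addxx.
Qed.

(** * Symmetric matrices: minimal polynomial, trace and rank *)

Lemma mulmx_tr_eq0 (R : realDomainType) (m n : nat) (A : 'M[R]_(m, n)) :
  A^T *m A = 0 -> A = 0.
Proof.
move=> A0; apply/matrixP => i j; rewrite [RHS]mxE; apply/eqP.
have /eqP := congr1 (fun B : 'M_n => B j j) A0; rewrite !mxE.
rewrite psumr_eq0 => [|l _]; last by rewrite mxE -expr2 sqr_ge0.
by move=> /allP/(_ i (mem_index_enum _)); rewrite mxE mulf_eq0 orbb.
Qed.

Lemma horner_mx_sym (R : comNzRingType) (n : nat) (A : 'M[R]_n.+1) (p : {poly R}) :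
  A^T = A -> (horner_mx A p)^T = horner_mx A p.
Proof.
move=> symA; elim/poly_ind: p => [|p c IHp]; first by rewrite rmorph0 trmx0.
rewrite rmorphD rmorphM /= horner_mx_X horner_mx_C linearD /= trmx_mul.
rewrite IHp symA tr_scalar_mx; congr (_ + _).
exact/comm_mx_horner.
Qed.

(** Over an ordered domain a symmetric matrix with zero square is zero, so a repeated factor of an
    annihilating polynomial can be made simple. *)
Lemma sym_horner_mx_expS (R : realDomainType) (n m : nat) (A : 'M[R]_n.+1)
    (p q : {poly R}) : A^T = A ->
  horner_mx A (p ^+ m.+1 * q) = 0 -> horner_mx A (p * q) = 0.
Proof.
move=> symA; elim: m q => [|m IHm] q //; rewrite exprSr -mulrA => /IHm pq0.
(* (p q)(A) is symmetric, and its square is p^2 q (A) * q (A) = 0. *)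
apply: mulmx_tr_eq0; rewrite (horner_mx_sym _ _ _ _ symA).
rewrite -[LHS]rmorphM /= (_ : p * q * (p * q) = p * (p * q) * q); last by ring.
by rewrite rmorphM /= pq0 mul0r.
Qed.

Lemma sym_mxminpoly (R : rcfType) (n : nat) (A : 'M[R]_n.+1) (s : seq (R * nat)) :
  A^T = A -> has_spectrum A s -> mxminpoly A = \prod_(x <- unzip1 s) ('X - x%:P).
Proof.
move=> symA sp; have [us sgt0 chA] := sp.
apply/eqP; rewrite -eqp_monic ?mxminpoly_monic ?monic_prod_XsubC //.
apply/andP; split; last first.
  apply: uniq_roots_dvdp; last by rewrite uniq_rootsE.
  by apply/allP => x xs; rewrite -eigenvalue_root_min (has_spectrum_eigenvalue sp).
apply: mxminpoly_min.
(* [q] collects the factors already made simple, so that the induction on [s] goes through. *)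
suff kill q : horner_mx A (\prod_(xm <- s) ('X - xm.1%:P) ^+ xm.2 * q) = 0 ->
    horner_mx A (\prod_(xm <- s) ('X - xm.1%:P) * q) = 0.
  by have := kill 1; rewrite !mulr1 -chA big_map; apply; apply: Cayley_Hamilton.
elim: s sgt0 q {us chA sp} => [|[x m] s IHs] sgt0 q; first by rewrite !big_nil.
have /= mgt0 := sgt0 (x, m) (mem_head _ _).
have s'gt0 : {in s, forall xm, (0 < xm.2)%N}.
  by move=> y ys; apply: sgt0; rewrite inE ys orbT.
rewrite !big_cons /= -!mulrA -(prednK mgt0).
move=> /(sym_horner_mx_expS _ _ _ _ _ _ symA) e; rewrite mulrCA.
by apply: (IHs s'gt0); rewrite mulrCA.
Qed.

Lemma char_poly_uconj (R : comUnitRingType) (n : nat) (V A : 'M[R]_n) :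
  V \in unitmx -> char_poly (invmx V *m A *m V) = char_poly A.
Proof.
move=> uV; pose f := @map_mx R {poly R} polyC n n.
have VV : f (invmx V) *m f V = 1%:M by rewrite -map_mxM mulVmx // map_mx1.
have -> : char_poly (invmx V *m A *m V) = \det (f (invmx V) *m char_poly_mx A *m f V).
  rewrite /char_poly /char_poly_mx; congr (\det _).
  by rewrite !map_mxM mulmxBr mulmxBl mul_mx_scalar -scalemxAl VV scalemx1.
by rewrite !det_mulmx mulrAC -det_mulmx VV det1 mul1r.
Qed.

(** By unique factorization, [t] is a permutation of the diagonal of a diagonal form of [A]. *)
Lemma diagonalizable_trace_horner (F : fieldType) (n : nat) (A : 'M[F]_n.+1)
    (t : seq F) (p : {poly F}) :
  diagonalizable A -> char_poly A = \prod_(y <- t) ('X - y%:P) ->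
  \tr (horner_mx A p) = \sum_(y <- t) p.[y].
Proof.
move=> [V uV] /(diagonalizable_forLR uV)[D]; rewrite mxpoly.conjVmx // => ->.
rewrite char_poly_uconj // horner_mx_uconjC //.
rewrite mxtrace_mulC mulmxA mulmxV // mul1mx horner_mx_diag mxtrace_diag.
rewrite char_poly_trig ?diag_mx_is_trig // => chD.
have {}chD : \prod_(y <- [seq D 0 i | i <- enum 'I_n.+1]) ('X - y%:P) =
    \prod_(y <- t) ('X - y%:P).
  rewrite -chD big_map big_enum /=; apply: eq_bigr => i _.
  by rewrite mxE eqxx mulr1n.
rewrite -(perm_big _ (prod_XsubC_eq chD)) big_map big_enum /=.
by apply: eq_bigr => i _; rewrite mxE.
Qed.

(** For the full-rank factorization [M = A B], cancelling [A] and [B] in the hypothesis leaves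
    [B A = k I], of size the rank; [A B] and [B A] have the same trace. *)
Lemma mxrank_scaled_idem (F : fieldType) (n : nat) (M : 'M[F]_n) (k : F) :
  M *m M = k *: M -> \tr M = k *+ \rank M.
Proof.
move=> MM.
move: (col_base M) (row_base M) (mulmx_base M) (col_base_full M) (row_base_free M).
move=> A B defM fA fB.
have BA : B *m A = k%:M.
  apply: (row_free_inj fB); rewrite mul_scalar_mx; apply: (row_full_inj fA).
  by rewrite -scalemxAr defM -MM -[in RHS]defM !mulmxA.
by rewrite -[in LHS]defM mxtrace_mulC BA mxtrace_scalar.
Qed.

(** A principal 3 x 3 minor vanishes, as [M] is a sum of two products of a column and a row. *)
Lemma mxrank2_minor (F : fieldType) (n : nat) (M : 'M[F]_n) : \rank M = 2 ->
  M^T = M -> forall i j l,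
  M i i * M j j * M l l + 2 * (M i j * M i l * M j l) =
  M i i * M j l ^+ 2 + M j j * M i l ^+ 2 + M l l * M i j ^+ 2.
Proof.
move=> rM symM i j l.
have Msym i' j' : M i' j' = M j' i' by rewrite -[in LHS]symM mxE.
have ME : exists a b : 'I_n -> F, exists c d : 'I_n -> F,
    forall i j, M i j = a i * c j + b i * d j.
  move: (col_base M) (row_base M) (mulmx_base M); rewrite rM => A B <-.
  exists (A^~ 0), (A^~ 1), (B 0), (B 1) => i' j'.
  by rewrite !mxE big_ord_recl big_ord1; congr (_ + A _ _ * B _ _); apply: val_inj.
case: ME => a [b [c [d ME]]].
(* With transposed entries kept apart, the determinant vanishes identically in [a], [b], [c],
   [d]. *)
have -> : M j l ^+ 2 = M j l * M l j by rewrite (Msym l).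
have -> : M i l ^+ 2 = M i l * M l i by rewrite (Msym l).
have -> : M i j ^+ 2 = M i j * M j i by rewrite (Msym j).
have -> : 2 * (M i j * M i l * M j l) = M i j * M j l * M l i + M i l * M j i * M l j.
  by rewrite (Msym l i) (Msym l j) (Msym j i); ring.
by rewrite !ME; ring.
Qed.

(** * Division of the Gram matrix by a constant *)

(** The quotient [M / c] satisfies the hypotheses of [rank2_gram_sum]; a negative [c] takes care of
    a negative [d]. *)
Lemma divisible_gram_sum (n k p : nat) (M : 'M[int]_n) (c d : int) :
  prime p -> p = 3 %[mod 4] -> n = k.*2 -> (0 < n)%N -> M^T = M ->
  M *m M = (k%:Z * d) *: M -> (forall i, M i i = d) ->
  (forall i j l, d ^+ 3 + 2 * (M i j * M i l * M j l) =
    d * (M j l ^+ 2 + M i l ^+ 2 + M i j ^+ 2)) ->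
  c != 0 -> d = c * p%:Z -> (forall i j, (c %| M i j)%Z) ->
  exists i j, forall l, (M i l + M j l) ^+ 2 = d ^+ 2.
Proof.
move=> pp p34 nk n0 symM MM dM minM c0 dE cM.
pose Q := map_mx (divz^~ c) M.
have ME i j : M i j = c * Q i j by rewrite mxE mulrC divzK.
have defM : M = c *: Q by apply/matrixP => i j; rewrite mxE ME.
have scI : injective (fun X : 'M[int]_n => c *: X).
  by move=> X Y /matrixP e; apply/matrixP => i j; move: (e i j); rewrite !mxE; apply: mulfI.
have [|||i j l|i [j Qij]] := @rank2_gram_sum n k p Q pp p34 nk n0.
- by apply: scI; rewrite /= -linearZ /= -defM symM.
- apply: (scI); apply: (scI); rewrite /= scalerA.
  have -> : (c * c) *: (Q *m Q) = M *m M by rewrite defM -scalemxAl -scalemxAr scalerA.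
  by rewrite MM dE defM !scalerA; congr (_ *: _); rewrite PoszM; ring.
- by move=> i; apply: (mulfI c0); rewrite -ME dM dE.
- have c30 : c ^+ 3 != 0 by rewrite expf_neq0.
  apply: (mulfI c30); have := minM i j l; rewrite !ME dE => e.
  transitivity ((c * p) ^+ 3 + 2 * (c * Q i j * (c * Q i l) * (c * Q j l))); first by ring.
  by rewrite e; ring.
exists i, j => l; rewrite !ME dE -mulrDr !exprMn Qij //.
Qed.

Lemma seidel_gram_sum (n k p : nat) (S N M : 'M[int]_n) (t l q d : int) :
  prime p -> p = 3 %[mod 4] -> n = k.*2 -> (0 < n)%N ->
  N^T = N -> (forall i, N i i = 0) -> S = const_mx 1 - 1%:M - 2 *: N ->
  M = S *m S - t *: S + l%:M -> M^T = M ->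
  (2 %| t)%Z -> ~~ (2 %| l)%Z -> ~~ (2 %| q)%Z ->
  S *m M = q *: M -> M *m M = (k%:Z * d) *: M -> (forall i, M i i = d) ->
  (forall i j, (2 %| M i j)%Z) ->
  (forall i j l, d ^+ 3 + 2 * (M i j * M i l * M j l) =
    d * (M j l ^+ 2 + M i l ^+ 2 + M i j ^+ 2)) ->
  [\/ `|d| = p%:Z, `|d| = 2 * p%:Z | `|d| = 4 * p%:Z] ->
  exists i j, forall l, (M i l + M j l) ^+ 2 = d ^+ 2.
Proof.
move=> pp p34 nk n0 symN dN defS defM symM /dvdzP[tau tE] lodd qodd SM MM dM M2 minM dp.
have [e lE] : exists e, l = 2 * e - 1 by exists ((l + 1) %/ 2)%Z; lia.
have [q' qE] : exists q', q = 2 * q' - 1 by exists ((q + 1) %/ 2)%Z; lia.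
have p_odd : odd p by lia.
pose W := map_mx (divz^~ 2) M.
have ME i j : M i j = 2 * W i j by rewrite mxE mulrC divzK.
have MW : M = 2 *: W by apply/matrixP => i j; rewrite mxE ME.
have sc2I : injective (fun X : 'M[int]_n => 2 *: X).
  move=> X Y /matrixP XY; apply/matrixP => i j.
  by move: (XY i j); rewrite !mxE; apply: mulfI.
pose i0 : 'I_n := Ordinal n0.
have d2 : (2 %| d)%Z by rewrite -(dM i0).
have fin := @divisible_gram_sum n k p M _ d pp p34 nk n0 symM MM dM minM.
case: dp => dp.
(* Impossible: [d] is even and [p] is odd. *)
- by exfalso; lia.
- have [dp'|dp'] : d = 2 * p%:Z \/ d = - 2 * p%:Z by lia.
    exact: (fin 2).
  by apply: (fin (-2)) => // i j; rewrite dvdNz.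
(* Here [d / 2] is even, so the parity argument applies to [W = M / 2], of diagonal [d / 2]. *)
have W2 i j : (2 %| W i j)%Z.
  apply: (@seidel_gram_even n k S N W tau e (d %/ 2)%Z q') => //.
  - by rewrite -MW defM tE lE [tau * 2]mulrC.
  - apply: (sc2I); apply: (sc2I); rewrite /= scalerA.
    have -> : (2 * 2) *: (W *m W) = M *m M by rewrite MW -scalemxAl -scalemxAr scalerA.
    rewrite MM MW !scalerA; congr (_ *: _).
    by rewrite -[in LHS](divzK d2); ring.
  - by apply: sc2I; rewrite /= -linearZ /= -MW symM.
  - by apply: sc2I; rewrite /= -qE scalemxAr -MW SM MW !scalerA mulrC.
  - by move=> i'; rewrite mxE dM.
  by lia.
have M4 i j : (4 %| M i j)%Z by rewrite ME (_ : 4 = 2 * 2) // dvdz_mul2l ?W2.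
have [dp'|dp'] : d = 4 * p%:Z \/ d = - 4 * p%:Z by lia.
  exact: (fin 4).
by apply: (fin (-4)) => // i j; rewrite dvdNz.
Qed.

(** * Integrality of minimal polynomials and eigenvalues *)

(** Gauss' lemma makes [p] a rational multiple [a] of an integral divisor [p1] of [q]; as [q] is
    monic, [p1] has leading coefficient [u = +-1], and [p] monic forces [a = u]. *)
Lemma monic_dvdp_rat_int (p : {poly rat}) (q : {poly int}) :
  p \is monic -> q \is monic -> p %| map_poly intr q ->
  exists g r : {poly int}, p = map_poly intr g /\ q = g * r.
Proof.
move=> mp mq /dvdpP_rat_int[p1 [a a0 defp]] [r defq].
have lc1 : lead_coef p1 * lead_coef r = 1 by rewrite -lead_coefM -defq (monicP mq).
set u := lead_coef p1 in lc1.
have uu : u * u = 1 by case/intUnitRing.unitzPl: (etrans (mulrC _ _) lc1); nia.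
have au : a = u%:~R.
  have := monicP mp; rewrite defp lead_coefZ lead_coef_map_inj //; last exact: intr_inj.
  have u1 : u%:~R * u%:~R = 1 :> rat by rewrite -intrM uu.
  have u0 : u%:~R != 0 :> rat by rewrite intr_eq0; apply/eqP=> u0; rewrite u0 in uu.
  by move=> au1; apply: (mulIf u0); rewrite u1.
exists (u *: p1), (u *: r); split; first by rewrite defp map_polyZ /= au.
by rewrite -scalerAr -scalerAl scalerA uu scale1r.
Qed.

(** The minimal polynomial is the same over the rationals as over [R], and there it divides the
    integral characteristic polynomial. *)
Lemma mxminpoly_int (R : numFieldType) (n : nat) (S : 'M[int]_n.+1) :
  exists g r : {poly int}, mxminpoly (map_mx (intr : int -> R) S) = map_poly intr g
    /\ char_poly S = g * r.
Proof.
pose SQ := map_mx (intr : int -> rat) S.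
have [|||g [r [e1 e2]]] := monic_dvdp_rat_int (mxminpoly SQ) (char_poly S).
- exact: mxminpoly_monic.
- exact: char_poly_monic.
- by rewrite map_char_poly mxminpoly_dvd_char.
exists g, r; split=> //.
have -> : map_mx intr S = map_mx (ratr : rat -> R) SQ.
  by apply/matrixP => i j; rewrite !mxE ratr_int.
rewrite mxminpoly_map e1 -map_poly_comp.
by apply: eq_map_poly => x /=; rewrite ratr_int.
Qed.

Lemma char_poly_rat_root (R : numFieldType) (n : nat) (S : 'M[int]_n) (x : rat) :
  root (char_poly (map_mx (intr : int -> R) S)) (ratr x) -> exists z : int, x = z%:~R.
Proof.
have -> : map_mx intr S = map_mx (ratr : rat -> R) (map_mx intr S).
  by apply/matrixP => i j; rewrite !mxE ratr_int.
rewrite -map_char_poly fmorph_root -map_char_poly -dvdp_XsubCl => dv.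
have [g [r [e1 _]]] := monic_dvdp_rat_int _ _ (monicXsubC x) (char_poly_monic S) dv.
(* [g] is ['X - x], so its constant coefficient is [- x]. *)
exists (- g`_0).
have := congr1 (fun p : {poly rat} => p`_0) e1.
by rewrite coef_map coefB coefX coefC /= sub0r rmorphN /= => <-; rewrite opprK.
Qed.

(** Modulo 2 the matrix is [J + I] with [J] all ones, and [J *m J = n J = 0] as [n] is even. *)
Lemma seidel_F2 (n : nat) (N : 'M[int]_n) : ~~ odd n ->
  let T := map_mx (intr : int -> 'F_2) (const_mx 1 - 1%:M - 2 *: N) in T *m T = 1%:M.
Proof.
move=> n_even /=; set T := map_mx _ _.
have -> : T = const_mx 1 + 1%:M.
  apply/matrixP => i j; rewrite !mxE rmorphB /= F2_even subr0 rmorphB /= F2_opp.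
  by rewrite rmorph1 rmorph_nat.
have JJ : (const_mx 1 : 'M['F_2]_n) *m (const_mx 1 : 'M_n) = 0.
  apply/matrixP => i j; rewrite !mxE; under eq_bigr do rewrite !mxE mulr1.
  rewrite sumr_const card_ord -[n]odd_double_half (negPf n_even) add0n.
  by rewrite -muln2 mulrnA -mulr_natr F2_two mulr0.
rewrite mulmxDl !mulmxDr JJ !mulmx1 mul1mx add0r addrA.
have -> : (const_mx 1 : 'M['F_2]_n) + const_mx 1 = 0.
  by apply/matrixP => i j; rewrite !mxE F2_addxx.
by rewrite add0r.
Qed.

Lemma odd_detM (n : nat) (S : 'M[int]_n) :
  let T := map_mx (intr : int -> 'F_2) S in T *m T = 1%:M -> ~~ (2 %| \det S)%Z.
Proof.
move=> T TT; rewrite F2_dvd -det_map_mx; apply/eqP => d0.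
have := congr1 (@determinant _ n) TT; rewrite det_mulmx d0 mul0r det1.
by move/eqP; rewrite eq_sym oner_eq0.
Qed.

(** The constant coefficient of the minimal polynomial is [- lambda mu nu], an integer dividing
    [\det S], hence odd. So [nu] is rational and thus an integer, although [lambda] and [mu] may be
    irrational; their sum comes from the coefficient of degree 2. *)
Lemma three_eigenvalues_int (R : numFieldType) (n : nat) (S : 'M[int]_n.+1)
    (lambda mu nu : R) (l : int) : ~~ (2 %| \det S)%Z ->
  mxminpoly (map_mx intr S) = \prod_(x <- [:: lambda; mu; nu]) ('X - x%:P) ->
  lambda * mu = l%:~R ->
  exists t q : int, [/\ lambda + mu = t%:~R, nu = q%:~R, ~~ (2 %| l)%Z & ~~ (2 %| q)%Z].
Proof.
move=> detS minS lE; have [g [r [gE chE]]] := mxminpoly_int R n S.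
have g0E : (g`_0)%:~R = - (l%:~R * nu).
  rewrite -coef_map -gE minS coef0_prod_XsubC /= !big_cons big_nil -lE; ring.
have g0odd : ~~ (2 %| g`_0)%Z.
  apply: contra detS => g02.
  have := char_poly_det S; rewrite chE coef0M => e.
  have : (2 %| g`_0 * r`_0)%Z by rewrite dvdz_mulr.
  by rewrite e dvdzE abszMsign -dvdzE.
have l0 : l%:~R != 0 :> R.
  apply: contraNneq g0odd => l0; have /eqP := g0E.
  by rewrite l0 mul0r oppr0 intr_eq0 => /eqP->.
have [q qE] : exists q : int, nu = q%:~R.
  pose x : rat := - (g`_0)%:~R / l%:~R.
  have xE : ratr x = nu.
    by rewrite fmorph_div rmorphN /= !ratr_int g0E opprK mulrC mulKf.
  have [|q qE] := char_poly_rat_root R _ S x.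
    rewrite xE -root_mxminpoly minS root_prod_XsubC !inE eqxx !orbT //.
  by exists q; rewrite -xE qE ratr_int.
have lq : g`_0 = - (l * q) by apply: (@intr_inj R); rewrite g0E qE rmorphN rmorphM.
exists (- g`_2 - q), q; split=> //.
- rewrite rmorphB rmorphN /= -qE -coef_map -gE minS.
  rewrite (@coefPn_prod_XsubC _ [:: _; _; _]) // !big_cons big_nil; ring.
- by apply: contra g0odd => l2; rewrite lq rpredN dvdz_mulr.
by apply: contra g0odd => l2; rewrite lq rpredN dvdz_mull.
Qed.

(** * The integral matrix [M] and the eigenvector *)

Theorem theorem5p7 (R : rcfType) (n a b : nat) (S : 'M[R]_n)
    (lambda mu nu : R) :
  seidel S -> ~~ odd n ->
  has_spectrum S [:: (lambda, a); (mu, b); (nu, 2%N)] ->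
  [\/ prime_3mod4 `|n%:R - 1 + lambda * mu|,
      prime_3mod4 (`|n%:R - 1 + lambda * mu| / 2)
    | prime_3mod4 (`|n%:R - 1 + lambda * mu| / 4)] ->
  regular_eigenspace S nu.
Proof.
case: n S => [|n] S [symS dS offS] n_even sp hp.
  (* A matrix of order 0 has no eigenvalue. *)
  have := has_spectrum_eigenvalue sp nu; rewrite !inE eqxx !orbT.
  by rewrite /eigenvalue thinmx0 eqxx.
have [us sgt0 chS] := sp.
have [p [pp p34 dp]] : exists p, [/\ prime p, p = 3 %[mod 4] &
    [\/ `|n.+1%:R - 1 + lambda * mu| = p%:R,
        `|n.+1%:R - 1 + lambda * mu| = 2 * p%:R
      | `|n.+1%:R - 1 + lambda * mu| = 4 * p%:R]].
  case: hp => -[p [pp p34 e]]; exists p; split=> //.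
  - by constructor 1.
  - by constructor 2; rewrite -e; field.
  by constructor 3; rewrite -e; field.
have [d [dE dpZ]] : exists d : int, n.+1%:R - 1 + lambda * mu = d%:~R /\
    [\/ `|d| = p%:Z, `|d| = 2 * p%:Z | `|d| = 4 * p%:Z].
  have [m mE mp] : exists2 m : nat, `|n.+1%:R - 1 + lambda * mu| = m%:R &
      [\/ m = p, m = 2 * p | m = 4 * p]%N.
    case: dp => ->; [exists p|exists (2 * p)%N|exists (4 * p)%N];
      by rewrite ?natrM //; (constructor 1 + constructor 2 + constructor 3).
  have [x0|x0] := lerP 0 (n.+1%:R - 1 + lambda * mu).
    exists m%:Z; split; first by rewrite -pmulrn -mE ger0_norm.
    by case: mp => ->; [constructor 1|constructor 2|constructor 3]; lia.
  exists (- m%:Z); split.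
    by rewrite rmorphN /= -pmulrn -mE ltr0_norm // opprK.
  by case: mp => ->; [constructor 1|constructor 2|constructor 3]; lia.
pose k := n.+1./2.
have nk : n.+1 = k.*2 by rewrite -[LHS]odd_double_half (negPf n_even).
have [l ldef] : exists l : int, l = d - n.+1%:Z + 1 by eexists.
have lE : lambda * mu = l%:~R.
  by rewrite ldef rmorphD rmorphB /= -dE -[n.+1%:~R]/(n.+1%:R); ring.
have m1n1 : (-1 == 1 :> R) = false.
  by apply: lt_eqF; lra.
pose N : 'M[int]_n.+1 := \matrix_(i, j) (S i j == -1)%:R.
have symN : N^T = N by apply/matrixP => i j; rewrite !mxE -{1}symS mxE.
have dN i : N i i = 0 by rewrite mxE dS eq_sym oppr_eq0 oner_eq0.
have [SZ SZdef] : exists X : 'M[int]_n.+1, X = const_mx 1 - 1%:M - 2 *: N by eexists.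
have dSZ i : SZ i i = 0.
  by rewrite SZdef !mxE eqxx dS [0 == _]eq_sym oppr_eq0 oner_eq0.
have SE : S = map_mx intr SZ.
  apply/matrixP => i j; rewrite SZdef !mxE; have [->|ij] := eqVneq i j.
    by rewrite dS eq_sym oppr_eq0 oner_eq0.
  by case: (offS i j ij) => ->; rewrite ?eqxx // eq_sym m1n1.
have symSZ : SZ^T = SZ.
  by rewrite SZdef !linearB linearZ /= trmx_const tr_scalar_mx symN.
have F2S := seidel_F2 _ N n_even; rewrite /= -SZdef in F2S.
have minS := sym_mxminpoly _ _ _ _ symS sp; rewrite /= in minS.
have [|t [q [tE qE lodd qodd]]] :=
  three_eigenvalues_int R n SZ lambda mu nu l (odd_detM _ _ F2S) _ lE.
  by rewrite -SE.
have [M Mdef] : exists X : 'M[int]_n.+1, X = SZ *m SZ - t *: SZ + l%:M by eexists.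
have mapI (X Y : 'M[int]_n.+1) : map_mx (intr : int -> R) X = map_mx intr Y -> X = Y.
  by move=> /matrixP e; apply/matrixP => i j; have := e i j; rewrite !mxE => /intr_inj.
have MR : map_mx intr M = horner_mx S (('X - lambda%:P) * ('X - mu%:P)).
  rewrite (_ : _ * _ = 'X ^+ 2 - (t%:~R)%:P * 'X + (l%:~R)%:P); last first.
    by rewrite -tE -lE rmorphD rmorphM /=; ring.
  rewrite rmorphD rmorphB rmorphXn rmorphM /= horner_mx_X !horner_mx_C.
  by rewrite Mdef map_mxD map_mxB map_mxM map_mxZ map_scalar_mx /= -SE expr2 -!mulmxE mul_scalar_mx.
have symM : M^T = M.
  by rewrite Mdef linearD linearB /= linearZ /= trmx_mul tr_scalar_mx symSZ.
(* ['X - nu] times the quadratic defining [M] is the minimal polynomial of [S]. *)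
have SM : SZ *m M = q *: M.
  apply: mapI; rewrite map_mxM /= -SE map_mxZ /= -qE MR.
  have := mx_root_minpoly S; rewrite minS !big_cons big_nil mulr1.
  set H := horner_mx S _ => e.
  have : horner_mx S (('X - nu%:P) * (('X - lambda%:P) * ('X - mu%:P))) = 0.
    by rewrite -e; congr (horner_mx S _); ring.
  rewrite rmorphM rmorphB /= horner_mx_X horner_mx_C -/H => /eqP.
  by rewrite mulrBl subr_eq0 -mulmxE mul_scalar_mx => /eqP.
(* [kap], the value at [nu] of the quadratic defining [M], is the eigenvalue of [M] on the
   [nu]-eigenspace. *)
have [kap [kapE kap0]] : exists kap : int,
    kap%:~R = (nu - lambda) * (nu - mu) /\ kap != 0.
  exists (q ^+ 2 - t * q + l).
  have kE : (q ^+ 2 - t * q + l)%:~R = (nu - lambda) * (nu - mu) :> R.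
    by rewrite rmorphD rmorphB rmorphXn rmorphM /= -qE -tE -lE; ring.
  split=> //; rewrite -(intr_eq0 R) kE mulf_neq0 // subr_eq0.
    by apply: contraTneq us => ->; rewrite /= !inE eqxx !orbT.
  by apply: contraTneq us => ->; rewrite /= !inE eqxx !andbF.
have MM : M *m M = kap *: M.
  rewrite {1}Mdef mulmxDl mulmxBl -mulmxA -scalemxAl SM -scalemxAr SM mul_scalar_mx.
  rewrite !scalerA -scalerBl -scalerDl; congr (_ *: _).
  by apply: (@intr_inj R); rewrite kapE !rmorphD rmorphN !rmorphM /= -qE -tE -lE; ring.
(* The quadratic vanishes at [lambda] and [mu], so only the double eigenvalue [nu] contributes. *)
have trM : \tr M = kap *+ 2.
  have diagS : diagonalizable S.
    by apply/diagonalizableP; exists [:: lambda; mu; nu] => //; rewrite minS.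
  have chE : char_poly S = \prod_(y <- nseq a lambda ++ nseq b mu ++ nseq 2 nu) ('X - y%:P).
    by rewrite chS !big_cat !big_nseq !iter_mulr_1 !big_cons big_nil mulr1.
  apply: (@intr_inj R); rewrite rmorphMn /= kapE -trace_map_mx MR.
  rewrite (diagonalizable_trace_horner _ _ _ _ _ diagS chE).
  rewrite !big_cat !big_nseq !iter_addr_0 /= !hornerE.
  by rewrite !subrr mul0r mulr0 !mul0rn /= !add0r mulr2n.
(* The order is [n.+1], so the diagonal of [SZ *m SZ] is constantly [n], and [d = n + l]. *)
have dM i : M i i = d.
  have SS m : SZ i m * SZ m i = 1 - (i == m)%:R.
    rewrite SZdef !mxE [m == i]eq_sym; have [->|im] := eqVneq i m.
      by rewrite dS [0 == _]eq_sym oppr_eq0 oner_eq0.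
    by rewrite -{2}symS mxE; case: (S i m == -1).
  rewrite Mdef !mxE; under eq_bigr do rewrite SS.
  rewrite sumrB sumr_const card_ord (bigD1 i) //= eqxx big1 => [|m]; last first.
    by rewrite eq_sym => /negPf->.
  by rewrite dSZ ldef natz; lia.
have kapd : kap = k%:Z * d.
  have := trM; rewrite /mxtrace (eq_bigr (fun=> d)) // sumr_const card_ord.
  rewrite -[d *+ _]mulr_natr natz -[kap *+ 2]mulr_natr.
  have -> : n.+1%:Z = 2 * k%:Z by rewrite nk; lia.
  by move=> e; lra.
have rkM : \rank (map_mx (intr : int -> R) M) = 2.
  have : \tr (map_mx (intr : int -> R) M) = kap%:~R *+ 2.
    by rewrite trace_map_mx trM rmorphMn.
  rewrite (@mxrank_scaled_idem _ _ _ kap%:~R); last by rewrite -map_mxM MM map_mxZ.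
  by apply: mulrIn; rewrite intr_eq0.
have minM i j m : d ^+ 3 + 2 * (M i j * M i m * M j m) =
    d * (M j m ^+ 2 + M i m ^+ 2 + M i j ^+ 2).
  have symMR : (map_mx (intr : int -> R) M)^T = map_mx intr M by rewrite map_trmx symM.
  have := mxrank2_minor _ _ _ rkM symMR i j m; rewrite !mxE !dM => e.
  apply: (@intr_inj R); rewrite !(rmorphD, rmorphM, rmorphXn) /=.
  by move: e => /= e; rewrite !mulrDr -e; ring.
(* Modulo 2, [SZ *m SZ = I] and [l = q = 1], so [M] is [t SZ] and [SM] reads [t I = t SZ]; the zero
   diagonal of [SZ] gives [t = 0], whence [M = 0]. *)
have tM2 : (2 %| t)%Z /\ forall i j, (2 %| M i j)%Z.
  pose F2 := (intr : int -> 'F_2); pose T := map_mx F2 SZ.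
  have F2cases (x : 'F_2) : x != 0 -> x = 1.
    by case: x => [[|[|//]] ?] // _; apply: val_inj.
  have l1 : F2 l = 1 by apply: F2cases; rewrite -F2_dvd.
  have q1 : F2 q = 1 by apply: F2cases; rewrite -F2_dvd.
  have MF : map_mx F2 M = F2 t *: T.
    rewrite Mdef map_mxD map_mxB map_mxM map_mxZ map_scalar_mx /= F2S [l%:~R]l1.
    by apply/matrixP => i j; rewrite !mxE F2_opp addrAC F2_addxx add0r.
  have := congr1 (map_mx F2) SM; rewrite map_mxM map_mxZ /= MF -/T [q%:~R]q1 scale1r.
  rewrite -scalemxAr F2S => /matrixP/(_ ord0 ord0); rewrite !mxE eqxx mulr1.
  have -> : SZ ord0 ord0 = 0 by apply: dSZ.
  rewrite mulr0 => t0; split; first by rewrite F2_dvd; apply/eqP.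
  move=> i j; rewrite F2_dvd; move/matrixP/(_ i j): MF; rewrite !mxE.
  by rewrite [F2 t]t0 mul0r => Mij0; apply/eqP.
have [t2 M2] := tM2.
have d0 : d%:~R != 0 :> R.
  by rewrite intr_eq0; apply: contraNneq kap0 => d0; rewrite kapd d0 mulr0.
have [i [j Mij]] : exists i j, forall m, (M i m + M j m) ^+ 2 = d ^+ 2.
  apply: (@seidel_gram_sum n.+1 k p SZ N M t l q d) => //.
  by rewrite -kapd.
(* As [SZ] and [M] are symmetric, [SM] also makes the rows of [M] eigenvectors. *)
have Msub : (map_mx intr M <= eigenspace S nu)%MS.
  apply/eigenspaceP; rewrite SE -map_mxM qE -map_mxZ; congr (map_mx _ _).
  by rewrite -[LHS]trmxK trmx_mul symSZ symM SM linearZ /= symM.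
exists (d%:~R^-1 *: (row i (map_mx intr M) + row j (map_mx intr M))); split.
  by rewrite scalemx_sub // addmx_sub // (submx_trans (row_sub _ _)).
move=> m; rewrite !mxE; have /eqP := Mij m; rewrite eqf_sqr.
rewrite -rmorphD /=.
case/orP => /eqP ->; [left|right]; last rewrite rmorphN mulrN; by rewrite mulVf.
Qed.
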